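(* Let $(C_{\leq_C},\alpha,\gamma,A_{\leq_A})$ be a Galois insertion with $\langle C,\leq_C\rangle$ a complete lattice, let $\mathcal{F}$ be a class of monotonic functions $C\to C$, and let $\mathrm{Init},\mathrm{Safe}\subseteq C$. Then the decision problem ''given $f\in\mathcal{F}$, $c\in\mathrm{Init}$, $c'\in\mathrm{Safe}$: does there exist $a\in A$ such that $c\leq_C\gamma(a)$, $f(\gamma(a))\leq_C\gamma(a)$ and $\gamma(a)\leq_C c'$?'' is decidable if and only if the decision problem ''given $f\in\mathcal{F}$, $c\in\mathrm{Init}$, $c'\in\mathrm{Safe}$: does $\gamma\big(\mathrm{lfp}(\lambda x\in A.\ \alpha(c)\vee_A\alpha f\gamma(x))\big)\leq_C c'$ hold?'' is decidable.
   Context: A Galois connection between posets $\langle C,\leq_C\rangle$ and $\langle A,\leq_A\rangle$ is a pair of maps $\alpha:C\to A$, $\gamma:A\to C$ with $\alpha(c)\leq_A a\iff c\leq_C\gamma(a)$ for all $c\in C,a\in A$; it is a Galois insertion when $\alpha$ is surjective. Since $C$ is a complete lattice, so is $A$; $\vee_A$ is its join. $\alpha f\gamma$ denotes $\alpha\circ f\circ\gamma$, and $\mathrm{lfp}$ denotes the least fixpoint. The two decision problems have the same instances $\langle f,c,c'\rangle\in\mathcal{F}\times\mathrm{Init}\times\mathrm{Safe}$, presented in the same (arbitrary, fixed) encoding. *)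

(* Defs.v *)
From mathcomp Require Import all_boot all_order.
From mathcomp Require Import boolp classical_sets.

Set Implicit Arguments.
Unset Strict Implicit.
Unset Printing Implicit Defensive.

Import Order.TTheory.
Local Open Scope order_scope.
Local Open Scope classical_set_scope.

Definition infimums d (T : porderType d) (S : set T) : set T :=
  lbound S `&` ubound (lbound S).

Definition complete_lattice d (T : porderType d) : Prop :=
  forall S : set T, supremums S !=set0 /\ infimums S !=set0.

(* The default value [x] is returned only when [x] and [y] have no least upper
   bound; see [join_of_supremum]. *)
Definition join_of d (T : porderType d) (x y : T) : T :=
  supremum x [set x; y].

Definition fixpoints (T : Type) (h : T -> T) : set T := [set x | h x = x].

(* The default value [x0] is returned only when [h] has no least fixpoint;
   see [lfpP]. *)
Definition lfp d (T : porderType d) (x0 : T) (h : T -> T) : T :=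
  xget x0 (fixpoints h `&` lbound (fixpoints h)).

Definition galois_connection dC (C : porderType dC) dA (A : porderType dA)
    (alpha : C -> A) (gamma : A -> C) : Prop :=
  forall c a, alpha c <= a <-> c <= gamma a.

Definition galois_insertion dC (C : porderType dC) dA (A : porderType dA)
    (alpha : C -> A) (gamma : A -> C) : Prop :=
  galois_connection alpha gamma /\ (forall a, exists c, alpha c = a).

Lemma join_of_supremum d (T : porderType d) (x y : T) :
  complete_lattice T -> supremums [set x; y] (join_of x y).
Proof.
move=> /(_ [set x; y])[[s Hs] _]; rewrite /join_of /supremum ifF; last first.
  by apply/negbTE/set0P; exists x; left.
exact: xgetI Hs.
Qed.

Lemma lfpP d (T : porderType d) (x0 : T) (h : T -> T) :
  complete_lattice T -> {homo h : x y / x <= y} ->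
  fixpoints h (lfp x0 h) /\ lbound (fixpoints h) (lfp x0 h).
Proof.
move=> cT hh; rewrite /lfp.
have [_ [m [mlb mglb]]] := cT [set x | h x <= x].
have hm : h m <= m by apply: mglb => x hx; apply: (le_trans _ hx); apply/hh/mlb.
have mP : (fixpoints h `&` lbound (fixpoints h)) m.
  split => [|x hx]; last by apply: mlb; rewrite /= hx.
  by apply: le_anti; rewrite hm; apply: mlb; apply: hh.
exact: (xgetI x0 mP).
Qed.

Lemma galois_insertion_complete dC (C : porderType dC) dA (A : porderType dA)
    (alpha : C -> A) (gamma : A -> C) :
  complete_lattice C -> galois_insertion alpha gamma -> complete_lattice A.
Proof.
move=> cC [gc surj] S.
have unit c : c <= gamma (alpha c) by apply/gc.
have gK a : alpha (gamma a) = a.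
  have [c <-] := surj a; apply: le_anti; apply/andP; split; first exact/gc.
  exact/gc/(le_trans (unit c))/unit.
have homog a b : a <= b -> gamma a <= gamma b.
  by move=> ab; apply/gc; rewrite gK.
have [[s [sub slub]] [m [mlb mglb]]] := cC (gamma @` S); split.
  exists (alpha s); split => [a Sa|b Sb].
    rewrite -(gK a); apply/gc; apply: (le_trans _ (unit s)).
    by apply: sub; exists a.
  by apply/gc; apply: slub => _ [a Sa <-]; apply/homog/Sb.
exists (alpha m); split => [a Sa|b Sb].
  by apply/gc; apply: mlb; exists a.
rewrite -(gK b); apply/gc; apply: (le_trans _ (unit m)).
by apply: mglb => _ [a Sa <-]; apply/homog/Sb.
Qed.

(* Kleene's partial recursive functions, indexed by their arity. *)
Inductive recfun : nat -> Type :=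
| RZero : recfun 0
| RSucc : recfun 1
| RProj n (i : 'I_n) : recfun n
| RComp k n (g : recfun k) (h : 'I_k -> recfun n) : recfun n
| RPrec n (g : recfun n) (h : recfun n.+2) : recfun n.+1
| RMu n (g : recfun n.+1) : recfun n.

Fixpoint prec_eval n (G : n.-tuple nat -> nat -> Prop)
    (H : n.+2.-tuple nat -> nat -> Prop) (v : n.-tuple nat) (k m : nat) : Prop :=
  if k is k'.+1
  then exists2 r, prec_eval G H v k' r & H [tuple of k' :: r :: v] m
  else G v m.

(* The graph of [f]: the computation of [f] on [v] halts with output [m]. *)
Fixpoint eval n (f : recfun n) : n.-tuple nat -> nat -> Prop :=
  match f in recfun n return n.-tuple nat -> nat -> Prop with
  | RZero => fun _ m => m = 0%N
  | RSucc => fun v m => m = (thead v).+1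
  | RProj _ i => fun v m => m = tnth v i
  | RComp k _ g h => fun v m =>
      exists2 w : k.-tuple nat,
        (forall i, eval (h i) v (tnth w i)) & eval g w m
  | RPrec _ g h => fun v m =>
      prec_eval (eval g) (eval h) [tuple of behead v] (thead v) m
  | RMu _ g => fun v m =>
      eval g [tuple of m :: v] 0%N /\
      (forall k, (k < m)%N -> exists r, eval g [tuple of k :: v] r.+1)
  end.

Lemma eval_functional n (f : recfun n) v m m' :
  eval f v m -> eval f v m' -> m = m'.
Proof.
elim: n / f v m m' => [||n i|k n g IHg h IHh|n g IHg h IHh|n g IHg] v m m' /=.
- by move=> -> ->.
- by move=> -> ->.
- by move=> -> ->.
- move=> [w Hw gw] [w' Hw' gw'].
  have eqw : w = w' by apply: eq_from_tnth => i; apply: IHh (Hw i) (Hw' i).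
  by subst w'; apply: IHg gw gw'.
- elim: (thead v) m m' => [|k IHk] m m' /=; first exact: IHg.
  by move=> [r kr hr] [r' /(IHk _ _ kr) <-]; apply: IHh hr.
- move=> [gm lm] [gm' lm']; case: (ltngtP m m') => // lt.
    by have [r /(IHg _ _ _ gm)] := lm' _ lt.
  by have [r /(IHg _ _ _ gm')] := lm _ lt.
Qed.

(* An encoding of the instances [I] names instances by natural numbers
   (equivalently, by finite words). Not every number need be a code and an
   instance may have several codes. Instances without a code are allowed, since
   [I] may be uncountable; surjective encodings are a special case. *)
Record encoding (X : Type) (I : set X) := Encoding {
  decode : nat -> option X;
  decode_instance : forall n x, decode n = Some x -> I x }.

Definition decidable_problem (X : Type) (I : set X) (e : encoding I)
    (P : X -> Prop) : Prop :=
  exists phi : recfun 1, forall n x, decode e n = Some x ->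
    (P x -> eval phi [tuple n] 1%N) /\ (~ P x -> eval phi [tuple n] 0%N).

(* Main.v *)
(* The two problems agree instance by instance.  By Knaster-Tarski, the least
   fixpoint of [fun x => alpha c \/ alpha (f (gamma x))] is also its least
   prefixpoint, and by adjunction the prefixpoints are exactly the abstract
   invariants [a] with [c <= gamma a] and [f (gamma a) <= gamma a]; so some
   invariant lies below [c'] iff the least one does. *)
Require Import Defs.
From mathcomp Require Import all_boot all_order.
From mathcomp Require Import boolp classical_sets.

Set Implicit Arguments.
Unset Strict Implicit.
Unset Printing Implicit Defensive.

Import Order.TTheory.
Local Open Scope order_scope.
Local Open Scope classical_set_scope.

(** The infimum [m] of all prefixpoints is itself a fixpoint, so [lfp x0 h] lies below [m], which
    lies below every prefixpoint [a]. *)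
Lemma lfp_le_prefixpoint d (T : porderType d) (x0 : T) (h : T -> T) (a : T) :
  complete_lattice T -> {homo h : x y / x <= y} -> h a <= a -> lfp x0 h <= a.
Proof.
move=> cT hh ha; have [_ [m [mlb mglb]]] := cT [set x | h x <= x].
have hm : h m <= m by apply: mglb => x hx; apply: (le_trans _ hx); apply/hh/mlb.
have fix_m : fixpoints h m.
  by apply: le_anti; rewrite hm; apply: mlb; apply: hh.
by apply: le_trans (mlb _ ha); apply: (lfpP x0 cT hh).2.
Qed.

Lemma join_of_le d (T : porderType d) (x y z : T) :
  complete_lattice T -> join_of x y <= z <-> x <= z /\ y <= z.
Proof.
move=> cT; have [ub lub] := join_of_supremum x y cT; split=> [le_z|[xz yz]].
  by split; apply: le_trans le_z; apply: ub; [left|right].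
by apply: lub => _ [->|->].
Qed.

Section GaloisInsertion.
Context dC (C : porderType dC) dA (A : porderType dA).
Context (alpha : C -> A) (gamma : A -> C).
Hypothesis gc : galois_connection alpha gamma.

Lemma galois_homo_alpha : {homo alpha : x y / x <= y}.
Proof. by move=> x y xy; apply/gc/(le_trans xy)/gc. Qed.

Lemma galois_homo_gamma : {homo gamma : x y / x <= y}.
Proof. by move=> a b ab; apply/gc; apply: le_trans ab; apply/gc. Qed.

Lemma abstract_invariant_lfp (f : C -> C) (c c' : C) :
  complete_lattice A -> {homo f : x y / x <= y} ->
  (exists a : A, [/\ c <= gamma a, f (gamma a) <= gamma a & gamma a <= c']) <->
  gamma (lfp (alpha c) (fun x : A => join_of (alpha c) (alpha (f (gamma x)))))
    <= c'.
Proof.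
move=> cA f_homo; set h := (X in lfp _ X).
(* The join splits into two inequalities, and the adjunction moves each [alpha] across as a
   [gamma]. *)
have hP a : h a <= a <-> c <= gamma a /\ f (gamma a) <= gamma a.
  by split=> [/(join_of_le _ _ _ cA)[/gc ? /gc]//|[/gc ? /gc ?]]; apply/join_of_le.
have h_homo : {homo h : x y / x <= y}.
  (* Reflexivity at [h y] shows that both joinands of [h y] lie below it. *)
  move=> x y xy; have [ub_c ub_f] := (join_of_le _ _ _ cA).1 (lexx (h y)).
  apply/join_of_le => //; split=> //; apply: le_trans ub_f.
  exact/galois_homo_alpha/f_homo/galois_homo_gamma.
split=> [[a [ca fa ac']]|lfp_c'].
  apply: le_trans ac'; apply/galois_homo_gamma/lfp_le_prefixpoint => //.
  exact/hP.
(* The least fixpoint is itself the witness. It exists because [h] is monotone on a complete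
   lattice, so the default [alpha c] is never what makes [lfp] meaningful. *)
have [h_lfp _] := lfpP (alpha c) cA h_homo.
have [|? ?] := (hP (lfp (alpha c) h)).1; first by rewrite h_lfp.
by exists (lfp (alpha c) h).
Qed.

End GaloisInsertion.

(** The same [phi] decides both problems. Agreement on [I] suffices, since every decoded number
    yields an element of [I]. *)
Lemma eq_decidable_problem (X : Type) (I : set X) (e : encoding I)
    (P Q : X -> Prop) :
  (forall x, I x -> P x <-> Q x) ->
  decidable_problem e P <-> decidable_problem e Q.
Proof.
move=> PQ; split=> -[phi phiP]; exists phi => n x en;
  have [pq qp] := PQ x (decode_instance en); have [yes no] := phiP n x en.
- by split=> [/qp//|nq]; apply: no => /pq.
- by split=> [/pq//|np]; apply: no => /qp.
Qed.

Theorem corollary3p4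
    (dC : Order.disp_t) (C : porderType dC)
    (dA : Order.disp_t) (A : porderType dA)
    (alpha : C -> A) (gamma : A -> C)
    (C_complete : complete_lattice C)
    (C_A_insertion : galois_insertion alpha gamma)
    (F : set (C -> C))
    (F_monotone : forall f, F f -> {homo f : x y / x <= y})
    (Init Safe : set C)
    (e : encoding (F `*` Init `*` Safe)) :
  decidable_problem e (fun '(f, c, c') =>
    exists a : A, [/\ c <= gamma a, f (gamma a) <= gamma a & gamma a <= c'])
  <->
  decidable_problem e (fun '(f, c, c') =>
    gamma (lfp (alpha c) (fun x : A => join_of (alpha c) (alpha (f (gamma x)))))
      <= c').
Proof.
(* Membership of the instance in the product supplies [F f], hence the monotonicity of [f]. *)
apply: eq_decidable_problem => -[[f c] c'] [[/= /F_monotone f_homo _] _].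
apply: abstract_invariant_lfp => //; first exact: C_A_insertion.1.
exact: galois_insertion_complete C_complete C_A_insertion.
Qed.
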